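(* Let a block consist of $n$ labelled samples $\boldsymbol{x}_1,\dots,\boldsymbol{x}_n\in\mathbb{R}^m$, each labelled either ''target'' or ''non-target''. Let $\mathrm{FS}(\boldsymbol{x}_j)$ be the feature-weighted sums of the samples, and let $c$ be a splitting threshold selected by the Learning Hyperplane Tree (LHT) rule with parameter $\gamma$; both are defined in the context. Assume: 1. $n\ge 2$, and the block contains at least one target sample and at least one non-target sample; 2. the values $\mathrm{FS}(\boldsymbol{x}_1),\dots,\mathrm{FS}(\boldsymbol{x}_n)$ are not all identical; 3. $\gamma$ is a positive integer with $1\le\gamma\le n$. Then the threshold $c$ always partitions the block into two non-empty subblocks: both $$B_1=\{\boldsymbol{x}_j \mid \mathrm{FS}(\boldsymbol{x}_j)<c\}\quad\text{and}\quad B_2=\{\boldsymbol{x}_j\mid \mathrm{FS}(\boldsymbol{x}_j)\ge c\}$$ are non-empty.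
   Context: **Feature weights.** Write $\boldsymbol{x}_j=(x_{1j},\dots,x_{mj})$. For each feature $i\in\{1,\dots,m\}$ let $\mathbb{E}[X_i]$ and $\mathbb{E}[X_i^2]$ be the sample means of the $i$-th feature and of its square over the $n$ samples of the block. Let $\mathbb{E}[X_i^{\mathrm{t}}]$ and $\mathbb{E}[X_i^{\mathrm{nt}}]$ be the sample means of the $i$-th feature over the target and the non-target samples of the block, respectively. Put $$\mathrm{SD}_i=\mathbb{E}[X_i^{\mathrm{t}}]-\mathbb{E}[X_i^{\mathrm{nt}}],\qquad \overline{\mathrm{SD}}=\max_{1\le i\le m}|\mathrm{SD}_i|,\qquad w_i=\mathrm{SD}_i/\overline{\mathrm{SD}},$$ where $\overline{\mathrm{SD}}>0$ so that the weights are defined. Given parameters $\alpha\ge 0$ and $0\le\beta\le 1$, only the features with $\mathbb{E}[X_i^2]-(\mathbb{E}[X_i])^2>\alpha$ and $|w_i|\ge\beta$ are used; every other feature is discarded, i.e. its weight $w_i$ is replaced by $0$. The feature-weighted sum is $$\mathrm{FS}(\boldsymbol{x}_j)=\sum_{i=1}^m w_i x_{ij}.$$ **Threshold selection.** Let $\mathcal{FS}=\{\mathrm{FS}(\boldsymbol{x}_j): 1\le j\le n\}$. Let $\min\mathrm{TFS}$ and $\max\mathrm{TFS}$ be the minimum and maximum of $\mathrm{FS}$ over the target samples, and $\min\mathrm{NFS}$ and $\max\mathrm{NFS}$ the minimum and maximum of $\mathrm{FS}$ over the non-target samples. Define - $N_1$ = number of target samples with $\mathrm{FS}(\boldsymbol{x}_j)<\min\mathrm{NFS}$,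 - $N_2$ = number of target samples with $\mathrm{FS}(\boldsymbol{x}_j)>\max\mathrm{NFS}$, - $N_3$ = number of non-target samples with $\mathrm{FS}(\boldsymbol{x}_j)<\min\mathrm{TFS}$, - $N_4$ = number of non-target samples with $\mathrm{FS}(\boldsymbol{x}_j)>\max\mathrm{TFS}$, and $N_{\max}=\max\{N_1,N_2,N_3,N_4\}$, $e=\tfrac14(\min\mathrm{NFS}+\max\mathrm{NFS}+\min\mathrm{TFS}+\max\mathrm{TFS})$. The threshold is $$c=\begin{cases}\min\mathrm{NFS}, & N_1=N_{\max}\text{ and }N_{\max}\ge\gamma,\\ \max\mathrm{NFS}+\delta_1, & N_2=N_{\max}\text{ and }N_{\max}\ge\gamma,\\ \min\mathrm{TFS}, & N_3=N_{\max}\text{ and }N_{\max}\ge\gamma,\\ \max\mathrm{TFS}+\delta_1, & N_4=N_{\max}\text{ and }N_{\max}\ge\gamma,\\ e, & N_{\max}<\gamma.\end{cases}$$ If several of the first four cases apply, any one of them may be used. Here $\delta_1>0$ is ''infinitesimally small'': $\max\mathrm{NFS}+\delta_1$ (respectively $\max\mathrm{TFS}+\delta_1$) is strictly smaller than the next larger value in $\mathcal{FS}$ after $\max\mathrm{NFS}$ (respectively $\max\mathrm{TFS}$), if such a value exists. *)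

(* Defs.v *)
From mathcomp Require Import all_boot all_order all_algebra.
From mathcomp Require Import reals.

Set Implicit Arguments.
Unset Strict Implicit.
Unset Printing Implicit Defensive.

Import Order.TTheory GRing.Theory Num.Theory.

Local Open Scope ring_scope.

(* A block of n labelled samples in R^m is given by a family
   x : 'I_n -> 'rV[R]_m together with the set T : {set 'I_n} of the indices of
   the target samples; the non-target samples are those indexed by ~: T.
   Subsets of the block are sets of indices, so that two samples with the same
   feature vector still count as two samples. *)

Definition mean_on (R : realType) (n : nat) (A : {set 'I_n}) (f : 'I_n -> R) : R :=
  (\sum_(j in A) f j) / #|A|%:R.

(* Minimum and maximum of f over A. Since the default value of the iterated
   operation is itself a value of f on A, these are the genuine extrema whenever
   A is non-empty; both are 0 when A is empty. *)
Definition min_on (R : realType) (n : nat) (A : {set 'I_n}) (f : 'I_n -> R) : R :=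
  let s := [seq f j | j in A] in \big[Num.min/head 0 s]_(v <- s) v.

Definition max_on (R : realType) (n : nat) (A : {set 'I_n}) (f : 'I_n -> R) : R :=
  let s := [seq f j | j in A] in \big[Num.max/head 0 s]_(v <- s) v.

Definition SD (R : realType) (m n : nat) (x : 'I_n -> 'rV[R]_m) (T : {set 'I_n})
    (i : 'I_m) : R :=
  mean_on T (fun j => x j 0 i) - mean_on (~: T) (fun j => x j 0 i).

(* The default value 0 of the iterated maximum is harmless: the terms are
   nonnegative. *)
Definition SDbar (R : realType) (m n : nat) (x : 'I_n -> 'rV[R]_m)
    (T : {set 'I_n}) : R :=
  \big[Num.max/0]_(i < m) `|SD x T i|.

Definition raw_weight (R : realType) (m n : nat) (x : 'I_n -> 'rV[R]_m)
    (T : {set 'I_n}) (i : 'I_m) : R :=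
  SD x T i / SDbar x T.

Definition feature_variance (R : realType) (m n : nat) (x : 'I_n -> 'rV[R]_m)
    (i : 'I_m) : R :=
  mean_on [set: 'I_n] (fun j => x j 0 i ^+ 2)
  - mean_on [set: 'I_n] (fun j => x j 0 i) ^+ 2.

Definition weight (R : realType) (m n : nat) (x : 'I_n -> 'rV[R]_m)
    (T : {set 'I_n}) (alpha beta : R) (i : 'I_m) : R :=
  if (alpha < feature_variance x i) && (beta <= `|raw_weight x T i|)
  then raw_weight x T i else 0.

Definition FS (R : realType) (m n : nat) (x : 'I_n -> 'rV[R]_m)
    (T : {set 'I_n}) (alpha beta : R) (v : 'rV[R]_m) : R :=
  \sum_(i < m) weight x T alpha beta i * v 0 i.

(* From here on f j stands for the feature-weighted sum of the j-th sample. *)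

Definition minTFS (R : realType) (n : nat) (T : {set 'I_n}) (f : 'I_n -> R) : R :=
  min_on T f.
Definition maxTFS (R : realType) (n : nat) (T : {set 'I_n}) (f : 'I_n -> R) : R :=
  max_on T f.
Definition minNFS (R : realType) (n : nat) (T : {set 'I_n}) (f : 'I_n -> R) : R :=
  min_on (~: T) f.
Definition maxNFS (R : realType) (n : nat) (T : {set 'I_n}) (f : 'I_n -> R) : R :=
  max_on (~: T) f.

Definition N1 (R : realType) (n : nat) (T : {set 'I_n}) (f : 'I_n -> R) : nat :=
  #|[set j in T | f j < minNFS T f]|.
Definition N2 (R : realType) (n : nat) (T : {set 'I_n}) (f : 'I_n -> R) : nat :=
  #|[set j in T | f j > maxNFS T f]|.
Definition N3 (R : realType) (n : nat) (T : {set 'I_n}) (f : 'I_n -> R) : nat :=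
  #|[set j in ~: T | f j < minTFS T f]|.
Definition N4 (R : realType) (n : nat) (T : {set 'I_n}) (f : 'I_n -> R) : nat :=
  #|[set j in ~: T | f j > maxTFS T f]|.

Definition Nmax (R : realType) (n : nat) (T : {set 'I_n}) (f : 'I_n -> R) : nat :=
  maxn (maxn (N1 T f) (N2 T f)) (maxn (N3 T f) (N4 T f)).

Definition mid_threshold (R : realType) (n : nat) (T : {set 'I_n})
    (f : 'I_n -> R) : R :=
  4^-1 * (minNFS T f + maxNFS T f + minTFS T f + maxTFS T f).

Definition next_value (R : realType) (n : nat) (f : 'I_n -> R) (a v : R) : Prop :=
  [/\ v \in codom f, a < v & forall u : R, u \in codom f -> a < u -> v <= u].

(* "Infinitesimally small" at the value a. *)
Definition small_increment (R : realType) (n : nat) (f : 'I_n -> R) (a d : R) : Prop :=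
  0 < d /\ (forall v : R, next_value f a v -> a + d < v).

(* lht_threshold T f gamma c: the number c can be selected by the rule. This is a
   relation because the first four cases may overlap, any applicable one being
   allowed, and because the increment d is only constrained to be small. *)
Inductive lht_threshold (R : realType) (n : nat) (T : {set 'I_n})
    (f : 'I_n -> R) (gamma : nat) : R -> Prop :=
| Threshold_minNFS :
    N1 T f = Nmax T f -> (gamma <= Nmax T f)%N ->
    lht_threshold T f gamma (minNFS T f)
| Threshold_maxNFS (d : R) :
    N2 T f = Nmax T f -> (gamma <= Nmax T f)%N ->
    small_increment f (maxNFS T f) d ->
    lht_threshold T f gamma (maxNFS T f + d)
| Threshold_minTFS :
    N3 T f = Nmax T f -> (gamma <= Nmax T f)%N ->
    lht_threshold T f gamma (minTFS T f)
| Threshold_maxTFS (d : R) :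
    N4 T f = Nmax T f -> (gamma <= Nmax T f)%N ->
    small_increment f (maxTFS T f) d ->
    lht_threshold T f gamma (maxTFS T f + d)
| Threshold_mid :
    (Nmax T f < gamma)%N ->
    lht_threshold T f gamma (mid_threshold T f).

Definition subblock_lt (R : realType) (n : nat) (f : 'I_n -> R) (c : R) : {set 'I_n} :=
  [set j | f j < c].
Definition subblock_ge (R : realType) (n : nat) (f : 'I_n -> R) (c : R) : {set 'I_n} :=
  [set j | f j >= c].

(* Main.v *)
(** When the largest count [Nmax] is at least [gamma >= 1], the sample counted
    lies strictly beyond an extremum of the other class, and a sample attaining
    that extremum lies on the other side of [c]; a small increment does not
    jump over the first of these. Otherwise [c] is the mean of
    four values of [f]: these cannot all be below [c], and if no value of [f]
    is below [c], all four equal [c], so the two classes both have [c] as their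
    minimum and maximum and [f] is constant. *)
Require Import Defs.
From mathcomp Require Import all_boot all_order all_algebra.
From mathcomp Require Import reals.
From mathcomp Require Import lra.

Set Implicit Arguments.
Unset Strict Implicit.
Unset Printing Implicit Defensive.

Import Order.TTheory GRing.Theory Num.Theory.

Local Open Scope ring_scope.

Lemma partition_setC (I : finType) (A : {set I}) :
  A != set0 -> ~: A != set0 -> partition [set A; ~: A] [set: I].
Proof.
move=> A0 CA0; rewrite -(setUCr A); apply: partitionU1 => //.
- by rewrite /partition cover1 eqxx trivIset1 inE eq_sym.
- by rewrite disjoints_subset setCK.
Qed.

Section Extrema.
Variables (R : realType) (n : nat) (A : {set 'I_n}) (f : 'I_n -> R).

(** The iterated extrema start from this default value, so it has to be a value of [f] on [A] for
    them to be attained there. *)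
Lemma image_head_mem : A != set0 ->
  head 0 [seq f j | j in A] \in [seq f j | j in A].
Proof.
case/set0Pn=> j jA; have : f j \in [seq f j | j in A] by apply: image_f.
by case: [seq f j | j in A] => //= v s _; rewrite mem_head.
Qed.

Lemma min_on_attained : A != set0 -> exists2 j, j \in A & f j = min_on A f.
Proof.
move=> A0; suff /imageP[j jA ->] : min_on A f \in [seq f j | j in A].
  by exists j.
rewrite /min_on big_seq; apply: (big_ind (fun v => v \in [seq f j | j in A])) => //.
- exact: image_head_mem.
- by move=> u v us vs; rewrite minEle; case: ifP.
Qed.

Lemma max_on_attained : A != set0 -> exists2 j, j \in A & f j = max_on A f.
Proof.
move=> A0; suff /imageP[j jA ->] : max_on A f \in [seq f j | j in A].
  by exists j.
rewrite /max_on big_seq; apply: (big_ind (fun v => v \in [seq f j | j in A])) => //.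
- exact: image_head_mem.
- by move=> u v us vs; rewrite maxEle; case: ifP.
Qed.

Lemma min_on_le j : j \in A -> min_on A f <= f j.
Proof. by move=> jA; apply: ge_bigmin_seq => //; apply: image_f. Qed.

Lemma max_on_ge j : j \in A -> f j <= max_on A f.
Proof. by move=> jA; apply: le_bigmax_seq => //; apply: image_f. Qed.

End Extrema.

(** Only finitely many indices have a value above [a]; one that minimises [f] among them gives
    [v]. *)
Lemma next_value_exists (R : realType) (n : nat) (f : 'I_n -> R) (a : R)
    (j : 'I_n) :
  a < f j -> exists2 v, next_value f a v & v <= f j.
Proof.
move=> aj; case: (arg_minP f (P := fun k => a < f k) aj) => k ak kmin.
exists (f k); last exact: kmin.
split=> //; first exact: codom_f.
by move=> _ /codomP[l ->] /kmin.
Qed.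

(** Smallness only compares [a + d] with the next value after [a], but [f j] is at least that
    value. *)
Lemma small_increment_lt (R : realType) (n : nat) (f : 'I_n -> R) (a d : R)
    (j : 'I_n) :
  small_increment f a d -> a < f j -> a + d < f j.
Proof.
by move=> [_ small] /next_value_exists[v /small adv vj]; apply: lt_le_trans vj.
Qed.

Section Threshold.
Variables (R : realType) (n : nat) (T : {set 'I_n}) (f : 'I_n -> R).
Hypotheses (T0 : T != set0) (CT0 : ~: T != set0).

(** Stated for any [A] so as to serve both classes: [~: T] for [N1], [T] for [N3]. *)
Lemma lt_min_on_separates (A : {set 'I_n}) (j : 'I_n) :
  A != set0 -> f j < min_on A f ->
  (exists j, f j < min_on A f) /\ (exists k, min_on A f <= f k).
Proof.
by move=> /(min_on_attained f)[k _ <-] jk; split; [exists j | exists k].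
Qed.

Lemma gt_max_on_separates (A : {set 'I_n}) (d : R) (j : 'I_n) :
  A != set0 -> small_increment f (max_on A f) d -> max_on A f < f j ->
  (exists j, f j < max_on A f + d) /\ (exists k, max_on A f + d <= f k).
Proof.
move=> /(max_on_attained f)[k _ kE] dsmall jk; split.
  (* Positivity of [d] puts the maximiser itself strictly below the threshold. *)
  by exists k; rewrite kE ltrDl; case: dsmall.
by exists j; rewrite ltW // small_increment_lt.
Qed.

Lemma mid_threshold_separates :
  ~ (forall j k, f j = f k) ->
  (exists j, f j < mid_threshold T f) /\ (exists k, mid_threshold T f <= f k).
Proof.
have [j1 _ e1] := min_on_attained f CT0; have [j2 _ e2] := max_on_attained f CT0.
have [j3 _ e3] := min_on_attained f T0; have [j4 _ e4] := max_on_attained f T0.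
have cE : 4 * mid_threshold T f = f j1 + f j2 + f j3 + f j4.
  by rewrite /mid_threshold /minNFS /maxNFS /minTFS /maxTFS -e1 -e2 -e3 -e4; lra.
set c := mid_threshold T f in cE *; move=> nconst; split.
  have [/existsP //|/existsPn ge] := boolP [exists j, f j < c].
  have {}ge j : c <= f j by rewrite leNgt ge.
  have fc j : f j = c.
    have := (ge j1, ge j2, ge j3, ge j4) => -[[[g1 g2] g3] g4].
    apply/eqP; rewrite eq_le ge andbT.
    (* By [cE], each of the four extrema is [4 * c] minus three terms that are at least [c], hence
       at most [c]; the maximum of the class of [j] then bounds [f j]. *)
    have [jT|jNT] := boolP (j \in T).
      by have := max_on_ge f jT; rewrite -e4; lra.
    have : j \in ~: T by rewrite inE.
    by move=> /(max_on_ge f); rewrite -e2; lra.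
  by case: nconst => j k; rewrite !fc.
have [/existsP //|/existsPn lt] := boolP [exists k, c <= f k].
have {}lt j : f j < c by rewrite ltNge lt.
by have := (lt j1, lt j2, lt j3, lt j4) => -[[[? ?] ?] ?]; lra.
Qed.

Lemma lht_threshold_separates (gamma : nat) (c : R) :
  ~ (forall j k, f j = f k) -> (0 < gamma)%N -> lht_threshold T f gamma c ->
  (exists j, f j < c) /\ (exists k, c <= f k).
Proof.
move=> nconst gamma_gt0; case=> [NE|d NE|NE|d NE|_];
  last exact: mid_threshold_separates;
  (* Since [gamma] is positive, the count that equals [Nmax] is nonzero and yields a counted sample
     [j]. *)
  move=> /(leq_trans gamma_gt0); rewrite -NE => /card_gt0P[j];
  rewrite inE => /andP[_ jlt].
- exact: lt_min_on_separates jlt.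
- by move=> dsmall; apply: gt_max_on_separates jlt.
- exact: lt_min_on_separates jlt.
- by move=> dsmall; apply: gt_max_on_separates jlt.
Qed.

End Threshold.

Theorem theorem1 (R : realType) (m n : nat) (x : 'I_n -> 'rV[R]_m)
    (T : {set 'I_n}) (alpha beta : R) (gamma : nat) (c : R)
    (f := fun j : 'I_n => FS x T alpha beta (x j)) :
  0 <= alpha ->
  0 <= beta <= 1 ->
  0 < SDbar x T ->
  (2 <= n)%N ->
  T != set0 ->
  ~: T != set0 ->
  ~ (forall j k : 'I_n, f j = f k) ->
  (1 <= gamma <= n)%N ->
  lht_threshold T f gamma c ->
  [/\ subblock_lt f c != set0,
      subblock_ge f c != set0
    & partition [set subblock_lt f c; subblock_ge f c] [set: 'I_n]].
Proof.
move=> _ _ _ _ T0 CT0 nconst /andP[gamma_gt0 _].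
move=> /(lht_threshold_separates T0 CT0 nconst gamma_gt0)[[j jc] [k ck]].
have lt0 : subblock_lt f c != set0 by apply/set0Pn; exists j; rewrite inE.
have ge0 : subblock_ge f c != set0 by apply/set0Pn; exists k; rewrite inE.
have geE : subblock_ge f c = ~: subblock_lt f c.
  by apply/setP=> i; rewrite !inE leNgt.
by split=> //; rewrite geE partition_setC // -geE.
Qed.
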